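(* Let $G$ be a digraph, ${tzn}(G)$ its tree-zig-zag number and $dtw(G)$ its directed treewidth. Then ${tzn}(G)\le 9\cdot dtw(G)+18$.
   Context: A binary tree is $(N,F)$ with $N$ a finite, prefix closed, well numbered subset of $\{1,2\}^*$ (well numbered: $p2\in N$ implies $p1\in N$) and $F=\{(p,pj):p,pj\in N\}$; $N(p)$ is the set of descendants of $p$ (including $p$). An olive-tree decomposition of a digraph $G=(V,E)$ is a triple $\mathcal{T}=(N,F,\mathfrak{m})$ with $(N,F)$ a binary tree and $\mathfrak{m}:V\to N$ injective; $V(p,\mathcal{T})=\mathfrak{m}^{-1}(N(p))$. For disjoint $V_1,V_2\subseteq V$, $E(V_1,V_2)$ is the set of edges with one endpoint in $V_1$ and the other in $V_2$. A simple path $\mathfrak{p}=v_1e_1\dots e_{n-1}v_n$ (with $e_i$ from $v_i$ to $v_{i+1}$, vertices pairwise distinct) has edge set $E_{\mathfrak{p}}$; $w(\mathcal{T},\mathfrak{p})=\max_{u\in N}|E_{\mathfrak{p}}\cap E(V(u,\mathcal{T}),V\setminus V(u,\mathcal{T}))|$. The tree-zig-zag number of $\mathcal{T}$ is $\max\{w(\mathcal{T},\mathfrak{p}):\mathfrak{p}$ a simple path in $G\}$, and ${tzn}(G)$ is the minimum over all olive-tree decompositions of $G$. Directed treewidth: an $r$-ary tree is $(N,F)$ with $N\subseteq\{1,\dots,r\}^*$ finite, prefix closed, well numbered. For disjoint $Z,K\subseteq V$, $K$ is $Z$-normal if no directed walk in $G\setminus Z$ with first and last vertex in $K$ uses a vertex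 of $V\setminus(Z\cup K)$. An arboreal decomposition is $(N,F,W,Z)$ with $(N,F)$ an $r$-ary tree, $W:N\to 2^V$, $Z:F\to2^V$, $\{W(p)\}$ a partition of $V$ into non-empty sets, and for each $(p,pj)\in F$, $\bigcup_{u\in N(pj)}W(u)$ is $Z(p,pj)$-normal; width is the least $w$ with $|W(p)\cup\bigcup_{e\sim p}Z(e)|\le w+1$ for all $p$ ($e\sim p$: arc incident with $p$). $dtw(G)$ is the minimum width of an arboreal decomposition. *)

(* Defs.v *)
From mathcomp Require Import all_boot finmap.
From mathcomp Require Import boolp.

Set Implicit Arguments.
Unset Strict Implicit.
Unset Printing Implicit Defensive.

(* The alphabet {1, ..., r} is represented by 'I_r = {0, ..., r - 1}. *)
Notation word r := (seq 'I_r).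

Definition prefix_closed r (N : {fset word r}) : Prop :=
  forall p q : word r, prefix p q -> q \in N -> p \in N.

Definition well_numbered r (N : {fset word r}) : Prop :=
  forall (p : word r) (i j : 'I_r), i < j -> rcons p j \in N -> rcons p i \in N.

(* The empty tree is allowed: it carries the decompositions of the empty
   digraph. *)
Definition is_tree r (N : {fset word r}) : Prop :=
  prefix_closed N /\ well_numbered N.

Definition arcs r (N : {fset word r}) : {fset word r * word r} :=
  [fset a in N `*` N | [exists j : 'I_r, a.2 == rcons a.1 j]]%fset.

Definition descendants r (N : {fset word r}) (p : word r) : {fset word r} :=
  [fset q in N | prefix p q]%fset.

(* A digraph is a finite type V of vertices with its adjacency relation
   e : rel V; its edges are the pairs (u, v) such that e u v. *)

Definition simple_path (V : finType) (e : rel V) (s : seq V) : bool :=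
  if s is x :: s' then path e x s' && uniq (x :: s') else false.

Definition path_edges (V : finType) (s : seq V) : {set V * V} :=
  [set a in zip s (behead s)].

Definition edges_between (V : finType) (e : rel V) (A B : {set V}) :
    {set V * V} :=
  [set a | e a.1 a.2 &
    ((a.1 \in A) && (a.2 \in B)) || ((a.1 \in B) && (a.2 \in A))].

Record olive_tree (V : finType) := OliveTree {
  olive_nodes : {fset word 2};
  olive_map : V -> olive_nodes;
  olive_is_tree : is_tree olive_nodes;
  olive_map_inj : injective olive_map
}.

Definition olive_part (V : finType) (T : olive_tree V) (p : word 2) : {set V} :=
  [set v | val (olive_map T v) \in descendants (olive_nodes T) p].

Definition path_weight (V : finType) (e : rel V) (T : olive_tree V)
    (s : seq V) : nat :=
  \max_(u <- olive_nodes T)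
    #|path_edges s :&: edges_between e (olive_part T u) (~: olive_part T u)|.

(* A simple path has at most #|V| vertices, so the finite type #|V|.-bseq V
   contains them all. *)
Definition olive_tzn (V : finType) (e : rel V) (T : olive_tree V) : nat :=
  \max_(s : #|V|.-bseq V | simple_path e s) path_weight e T s.

Lemma olive_tree_exists (V : finType) : inhabited (olive_tree V).
Proof.
pose z : 'I_2 := ord0.
pose N : {fset word 2} := [fset x in [seq nseq i z | i <- iota 0 #|V|]]%fset.
have inN q : (q \in N) = (q == nseq (size q) z) && (size q < #|V|).
  rewrite !inE; apply/mapP/andP => [[i]|[/eqP qE lt_q]].
    by rewrite mem_iota add0n => lt_i ->; rewrite size_nseq eqxx.
  by exists (size q) => //; rewrite mem_iota.
have tN : is_tree N.
  split=> [p q pq | p i j lt_ij].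
    rewrite !inN => /andP[/eqP qE lt_q].
    move: pq; rewrite prefixE => /eqP pE.
    rewrite (leq_ltn_trans _ lt_q) ?andbT; last first.
      by rewrite -pE size_take_min geq_minr.
    apply/eqP/all_pred1P; rewrite -pE; apply/allP => x /mem_take.
    by rewrite qE mem_nseq => /andP[_].
  rewrite !inN !size_rcons => /andP[/eqP jE _].
  have: all (pred1 z) (rcons p j) by apply/all_pred1P; rewrite size_rcons.
  by rewrite all_rcons /= => /andP[/eqP jz _]; rewrite jz in lt_ij.
have mN (v : V) : nseq (enum_rank v) z \in N.
  by rewrite inN size_nseq eqxx ltn_ord.
constructor; apply: (@OliveTree V N (fun v => [` mN v]%fset) tN) => u v /(congr1 val).
move=> /= /(congr1 size); rewrite !size_nseq => /ord_inj.
exact: enum_rank_inj.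
Qed.

Lemma tzn_exists (V : finType) (e : rel V) :
  exists k, `[< exists T : olive_tree V, olive_tzn e T = k >].
Proof.
by have [T] := olive_tree_exists V; exists (olive_tzn e T); apply/asboolP; exists T.
Qed.

Definition tzn (V : finType) (e : rel V) : nat := ex_minn (tzn_exists e).

(* Normality is a notion for disjoint Z and K only, whence the first conjunct. *)
Definition normal_set (V : finType) (e : rel V) (Z K : {set V}) : Prop :=
  [disjoint Z & K] /\
  ~ exists (x : V) (s : seq V),
      [/\ path e x s, all (fun v => v \notin Z) (x :: s),
          x \in K, last x s \in K
        & has (fun v => v \notin Z :|: K) (x :: s)].

(* Only the values of the bags on the nodes and of the guards on the arcs of
   the tree are relevant. *)
Record arboreal (V : finType) (e : rel V) := Arboreal {
  arb_arity : nat;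
  arb_nodes : {fset word arb_arity};
  arb_bag : word arb_arity -> {set V};
  arb_guard : word arb_arity * word arb_arity -> {set V};
  arb_is_tree : is_tree arb_nodes;
  arb_bag_neq0 : forall p, p \in arb_nodes -> arb_bag p != set0;
  arb_bag_disjoint : forall p q, p \in arb_nodes -> q \in arb_nodes ->
    p != q -> [disjoint arb_bag p & arb_bag q];
  arb_bag_cover : \bigcup_(p <- arb_nodes) arb_bag p = [set: V];
  arb_normal : forall a, a \in arcs arb_nodes ->
    normal_set e (arb_guard a)
      (\bigcup_(u <- descendants arb_nodes a.2) arb_bag u)
}.

Definition arb_ball (V : finType) (e : rel V) (D : arboreal e)
    (p : word (arb_arity D)) : {set V} :=
  arb_bag p :|:
  \bigcup_(a <- arcs (arb_nodes D) | (a.1 == p) || (a.2 == p)) arb_guard a.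

Lemma arb_width_exists (V : finType) (e : rel V) (D : arboreal e) :
  exists w, all (fun p => #|arb_ball p| <= w + 1) (arb_nodes D).
Proof.
exists #|V|; apply/allP => p _; rewrite addn1.
by apply: (leq_trans (max_card _)).
Qed.

Definition arb_width (V : finType) (e : rel V) (D : arboreal e) : nat :=
  ex_minn (arb_width_exists D).

Lemma arboreal_exists (V : finType) (e : rel V) : inhabited (arboreal e).
Proof.
case: (posnP #|V|) => [V0 | V0].
  have tN : is_tree (fset0 : {fset word 0}) by split=> p q; rewrite ?inE // => -[].
  constructor; apply: (@Arboreal V e 0 fset0 (fun=> set0) (fun=> set0)) => //.
    by apply/setP => x; have := fintype0 x V0.
  by move=> a; rewrite !inE.
have inN (q : word 0) : (q \in [fset ([::] : word 0)]%fset) = (q == [::]).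
  by rewrite inE.
have tN : is_tree [fset ([::] : word 0)]%fset.
  by split=> [p q | p []//]; rewrite !inN => pq /eqP q0; rewrite q0 prefixs0 in pq.
constructor; apply: (@Arboreal V e 0 _ (fun=> setT) (fun=> set0) tN).
- by move=> p _; rewrite -card_gt0 cardsT.
- by move=> p q; rewrite !inN => /eqP-> /eqP->; rewrite eqxx.
- by rewrite big_seq_fset1.
- by move=> a; rewrite !inE => /andP[_ /existsP[[]]].
Qed.

Lemma dtw_exists (V : finType) (e : rel V) :
  exists k, `[< exists D : arboreal e, arb_width D = k >].
Proof.
by have [D] := arboreal_exists e; exists (arb_width D); apply/asboolP; exists D.
Qed.

Definition dtw (V : finType) (e : rel V) : nat := ex_minn (dtw_exists e).

(* Main.v *)
Require Import Defs.
From mathcomp Require Import all_boot.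
From mathcomp Require Import finmap boolp zify.

Set Implicit Arguments.
Unset Strict Implicit.
Unset Printing Implicit Defensive.

(* From an arboreal decomposition of width k we only keep balanced separators:
   every Z has a set X of at most k + 1 vertices such that each strong
   component of G - X contains at most half of Z, namely the ball of a deepest
   node whose subtree carries more than half of Z.  The olive tree is then
   built top-down on sets K that no walk of G - Z can leave and re-enter, where
   |Z| <= 2k + 4.  Let X be a balanced separator for Z plus one vertex of K and
   S = Z :|: X.  First split off the vertices of K in X one by one, then the
   strong components C of G - S inside K, in topological order.  Each
   intermediate set U is such that a walk leaving and re-entering U meets S
   outside U, so that a simple path crosses its border at most
   2(|S| + 1) <= 6k + 14 times.  If D is the strong component of G - X
   containing C, then (Z :&: D) :|: X guards C and has again at most 2k + 4
   elements. *)

(** * Reachability and strong components after deletion of a guard *)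

Section Avoid.

Variables (V : finType) (e : rel V).
Implicit Types (Z S K U A B T : {set V}) (x y z u : V).

Definition avoid Z : rel V := [rel x y | [&& e x y, x \notin Z & y \notin Z]].

(** For u in Z this is the singleton of u, since [connect] is reflexive. *)
Definition scc Z u : {set V} :=
  [set y | connect (avoid Z) u y && connect (avoid Z) y u].

(** Normality restated with reachability in place of explicit walks. *)
Definition convex Z K : Prop :=
  [disjoint Z & K] /\
  forall x y z, x \in K -> z \in K ->
    connect (avoid Z) x y -> connect (avoid Z) y z -> y \in K.

Lemma connect_avoidS Z S x y :
  Z \subset S -> connect (avoid S) x y -> connect (avoid Z) x y.
Proof.
move=> /subsetP ZS; apply: connect_sub => a b /and3P[eab aS bS].
by apply: connect1; rewrite /avoid /= eab (contra (ZS a) aS) (contra (ZS b) bS).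
Qed.

Lemma sccS Z S u : Z \subset S -> scc S u \subset scc Z u.
Proof.
move=> ZS; apply/subsetP => y; rewrite !inE => /andP[uy yu].
by rewrite !(connect_avoidS ZS).
Qed.

Lemma connect_avoid_notin Z x y :
  x \notin Z -> connect (avoid Z) x y -> y \notin Z.
Proof.
move=> xZ /connectP[p + ->]; elim: p x xZ => //= z p IHp x _.
by move=> /andP[/and3P[_ _ zZ]]; apply: IHp.
Qed.

Lemma path_avoid Z x s :
  x \notin Z -> path (avoid Z) x s -> path e x s && all (fun v => v \notin Z) s.
Proof.
elim: s x => //= y s IHs x xZ /andP[/and3P[-> _ yZ] ps].
by rewrite yZ; apply: IHs.
Qed.

Lemma convex_normal Z K : normal_set e Z K -> convex Z K.
Proof.
move=> [dZK nwalk]; split=> // x y z xK zK /connectP[p pp yE] /connectP[q pq zE].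
apply/negP => /negP yK; apply: nwalk; exists x, (p ++ q).
have xZ : x \notin Z by rewrite (disjointFl dZK).
have yZ : y \notin Z by apply: (connect_avoid_notin xZ); apply/connectP; exists p.
have /andP[ep ap] := path_avoid xZ pp; have /andP[eq aq] := path_avoid yZ pq.
have yxp : y \in x :: p ++ q by rewrite -cat_cons mem_cat yE mem_last.
rewrite cat_path last_cat -yE ep eq -zE; split=> //.
  by rewrite -cat_cons all_cat /= xZ ap aq.
by apply/hasP; exists y; rewrite // inE negb_or yZ.
Qed.

Lemma convex_scc Z K S u : convex Z K -> Z \subset S -> u \in K -> scc S u \subset K.
Proof.
move=> [_ cvx] ZS uK; apply/subsetP => y; rewrite inE => /andP[uy yu].
by apply: (cvx u y u) => //; apply: connect_avoidS ZS _.
Qed.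

(** Every edge of a walk from x to y starts at a point reachable from x and ends at one that reaches
    y, so only such edges have to be transferred. *)
Lemma connect_refine (r r' : rel V) x y :
    connect r x y ->
    (forall a b, connect r x a -> r a b -> connect r b y -> r' a b) ->
  connect r' x y.
Proof.
move=> /connectP[p + ->]; elim: p x => //= z p IHp x /andP[xz pz] rr'.
have zy : connect r z (last z p) by apply/connectP; exists p.
apply: (connect_trans (connect1 _) (IHp z pz _)); first exact: rr'.
by move=> a b za; apply: rr'; apply: connect_trans za; apply: connect1.
Qed.

(** The guard contains X, so a walk that avoids it between two vertices of the component stays
    inside [scc X u]. There the guard and [Z :|: X] have the same vertices, so the walk avoids
    [Z :|: X] as well. *)
Lemma convex_scc_guard Z X u :
  u \notin Z :|: X -> convex ((Z :&: scc X u) :|: X) (scc (Z :|: X) u).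
Proof.
set Z' := (_ :&: _) :|: X; set S := Z :|: X => uS.
have XZ' : X \subset Z' by apply: subsetUr.
have Z'S : Z' \subset S by rewrite setSU ?subsetIl.
have XS : X \subset S by apply: subsetUr.
split=> [|x y z].
  apply: contraT; move=> /pred0Pn[y /= /andP[yZ']]; rewrite inE => /andP[uy _].
  by have := connect_avoid_notin uS uy; rewrite (subsetP Z'S).
rewrite !inE => /andP[ux xu] /andP[uz zu] xy yz.
have cX := connect_avoidS XZ'.
have step a b : connect (avoid Z') x a -> avoid Z' a b ->
    connect (avoid Z') b z -> avoid S a b.
  move=> xa ab bz; case/and3P: (ab) => eab aZ' bZ'; apply/and3P; split=> //.
    have aD : a \in scc X u.
      rewrite inE (connect_trans (connect_avoidS XS ux) (cX _ _ xa)).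
      by apply: connect_trans (connect_avoidS XS zu); apply/cX/(connect_trans (connect1 ab)).
    by move: aZ'; rewrite !in_setU in_setI aD andbT.
  have bD : b \in scc X u.
    rewrite inE (connect_trans (cX _ _ bz) (connect_avoidS XS zu)) andbT.
    apply: connect_trans (connect_avoidS XS ux) (cX _ _ _).
    by apply: connect_trans xa (connect1 ab).
  by move: bZ'; rewrite !in_setU in_setI bD andbT.
have xyS : connect (avoid S) x y.
  apply: connect_refine xy _ => a b xa ab byy.
  by apply: step => //; apply: connect_trans yz.
have yzS : connect (avoid S) y z.
  apply: connect_refine yz _ => a b ya ab bz.
  by apply: step => //; apply: connect_trans ya.
by rewrite (connect_trans ux xyS) (connect_trans yzS zu).
Qed.

End Avoid.

(** * How often a simple path crosses the border of a set *)

Section Crossing.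

Variables (V : finType) (e : rel V).
Implicit Types (Z S K U A B T : {set V}) (x y z u : V) (b : nat).

Definition crossing_le b U : Prop :=
  forall s, simple_path e s ->
    #|path_edges s :&: edges_between e U (~: U)| <= b.

Definition crosses U : pred (V * V) := fun a => (a.1 \in U) != (a.2 \in U).

(* T contains the vertices met since the last visit to U as long as the walk
   has avoided S; from there U cannot be re-entered. *)
Lemma count_crosses U S T x s :
    (forall y z, y \in U :|: T -> e y z -> z \notin U :|: S -> z \in T) ->
    (forall y z, y \in T -> e y z -> z \notin U) ->
    [disjoint T & U] ->
  path e x s ->
  count (crosses U) (zip (x :: s) s) <=
    2 * count (mem S) s + (if x \in U then 1 else if x \in T then 0 else 2).
Proof.
(* Amortised count: the last summand is a potential, equal to 1 in U (one exit left), 0 in T (no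
   re-entry) and 2 elsewhere (one entry and one exit). A visit to S pays 2, enough to restore it. *)
move=> UT TU dTU; elim: s x => //= y s IHs x /andP[exy /IHs {IHs}].
set c := count _ _; set c' := count _ _; rewrite /crosses /=.
have := UT x y; rewrite !inE exy => /(_ _ isT).
have := TU x y; rewrite exy => /(_ _ isT).
have := disjointFr dTU (x := x).
case: (x \in U); case: (x \in T) => //=;
  case: (y \in U); case: (y \in S); case: (y \in T) => //= H1 H2 H3;
  try lia; by [have := H1 isT|have := H2 isT|have := H3 isT isT].
Qed.

(** A simple path visits each vertex of S at most once, and the potential at its first vertex is at
    most 2. *)
Lemma crossing_le_sep U S T b :
    (forall y z, y \in U :|: T -> e y z -> z \notin U :|: S -> z \in T) ->
    (forall y z, y \in T -> e y z -> z \notin U) ->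
    [disjoint T & U] -> 2 * #|S| + 2 <= b ->
  crossing_le b U.
Proof.
move=> UT TU dTU Sb [//|x s] /= /andP[pxs /andP[_ us]].
have Ss : count (mem S) s <= #|S|.
  rewrite -size_filter -(card_uniqP (filter_uniq _ us)).
  by apply/subset_leq_card/subsetP => y; rewrite mem_filter => /andP[].
apply: leq_trans Sb; apply: (@leq_trans (count (crosses U) (zip (x :: s) s))).
  rewrite -size_filter; apply: leq_trans (card_size _).
  apply/subset_leq_card/subsetP => a; rewrite !inE mem_filter /crosses.
  by move=> /andP[-> /andP[_]]; case: (a.1 \in U); case: (a.2 \in U).
by apply: leq_trans (count_crosses UT TU dTU pxs) _; case: ifP => _; [|case: ifP => _]; lia.
Qed.

Lemma crossing_le0 b : crossing_le b set0.
Proof.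
move=> s _; rewrite (_ : _ :&: _ = set0) ?cards0 //.
by apply/setP => a; rewrite !inE !andbF.
Qed.

(** * From recursive splittings to olive trees *)

(** A recipe for an olive tree on U: A and B are the parts of the two children, and the at most one
    remaining vertex is mapped to the root. *)
Inductive splits b : {set V} -> Prop :=
| splits0 : splits b set0
| splitsU U A B : A :|: B \subset U -> [disjoint A & B] ->
    #|U :\: (A :|: B)| <= 1 -> crossing_le b U ->
    splits b A -> splits b B -> splits b U.

Definition graft (N1 N2 : {fset word 2}) : {fset word 2} :=
  ([::] |` ((cons ord0 @` N1) `|` (cons ord_max @` N2)))%fset.

Lemma ord2_neq0 (i : 'I_2) : i != ord0 -> i = ord_max.
Proof.
by rewrite -val_eqE /= => i0; apply: val_inj => /=; have := ltn_ord i; lia.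
Qed.

Lemma in_graft N1 N2 q :
  (q \in graft N1 N2) =
    if q is i :: p then p \in (if i == ord0 then N1 else N2) else true.
Proof.
rewrite !inE; case: q => [|i p] //=; apply/orP/idP.
  by case=> /imfsetP[p' /= p'N [-> ->]].
case: eqP => [->|/eqP/ord2_neq0 ->] pN; [left|right]; by apply/imfsetP; exists p.
Qed.

(** The root of N1 must be present because a second child is allowed only beside a first one. *)
Lemma is_tree_graft N1 N2 :
    [::] \in N1 -> is_tree N1 -> is_tree N2 -> is_tree (graft N1 N2).
Proof.
move=> root1 [pc1 wn1] [pc2 wn2]; split=> [p q|p i j lt_ij]; rewrite !in_graft.
  case: p q => [//|i p] [//|j q] /=; case: eqP => // <-.
  by case: eqP => _; [apply: pc1|apply: pc2].
case: p => [|k p] /=; last by case: eqP => _; [apply: wn1 lt_ij|apply: wn2 lt_ij].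
suff -> : i = ord0 by [].
by apply: val_inj => /=; have := ltn_ord j; lia.
Qed.

Lemma splits_tree b U : splits b U ->
  exists (N : {fset word 2}) (m : V -> word 2),
    [/\ is_tree N, [::] \in N, {in U, forall v, m v \in N},
        {in U &, injective m} &
        forall p, p \in N -> crossing_le b [set v in U | prefix p (m v)]].
Proof.
elim=> {U} [|U A B sABU dAB card1 crU _ [N1 [m1 [t1 r1 in1 inj1 cr1]]]
                                      _ [N2 [m2 [t2 r2 in2 inj2 cr2]]]].
  (* Even the empty set gets a one-node tree, so that every tree can be grafted as a first child. *)
  exists [fset [::]]%fset, (fun=> [::]); split=> //.
  - by split=> [p q|[|i p] j k _]; rewrite !inE //; case: p => [|k p] //; case: q.
  - by rewrite inE.
  - by move=> v; rewrite inE.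
  - by move=> v w; rewrite inE.
  by move=> p _; rewrite (_ : finset _ = set0);
     [apply: crossing_le0|apply/setP => v; rewrite !inE].
pose m v := if v \in A then ord0 :: m1 v else if v \in B then ord_max :: m2 v else [::].
exists (graft N1 N2), m; split.
- exact: is_tree_graft.
- by rewrite in_graft.
- move=> v _; rewrite in_graft /m; case: ifP => [/in1 //|_].
  by case: ifP => [/in2|].
- move=> v w vU wU; rewrite /m.
  case: (boolP (v \in A)) => vA; first case: (boolP (w \in A)) => wA.
  + by move=> [] /inj1; apply.
  + by case: ifP.
  case: (boolP (w \in A)) => wA; first by case: ifP.
  case: (boolP (v \in B)) => vB; case: (boolP (w \in B)) => wB //.
    by move=> [] /inj2; apply.
  (* Both vertices sit at the root, hence both are the single leftover vertex. *)
  by move=> _; apply: (card_le1_eqP card1); rewrite !inE ?negb_or ?vA ?vB ?wA ?wB.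
have sA v : v \in A -> v \in U by move=> vA; apply: (subsetP sABU); rewrite inE vA.
have sB v : v \in B -> v \in U by move=> vB; apply: (subsetP sABU); rewrite inE vB orbT.
case=> [_|i p]; first by rewrite (_ : finset _ = U) //; apply/setP => v;
  rewrite !inE prefix0s andbT.
rewrite in_graft; case: ifP => [/eqP-> /cr1|i0 /cr2].
  rewrite (_ : finset _ = [set v in U | prefix (ord0 :: p) (m v)]) //.
  apply/setP => v; rewrite !inE /m.
  case: (boolP (v \in A)) => [vA|_] /=; first by rewrite sA.
  by case: ifP => _; rewrite andbF.
rewrite (ord2_neq0 (negbT i0)).
rewrite (_ : finset _ = [set v in U | prefix (ord_max :: p) (m v)]) //.
apply/setP => v; rewrite !inE /m.
case: (boolP (v \in A)) => [vA|_] /=; first by rewrite (disjointFr dAB vA) andbF.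
by case: ifP => [vB|_]; rewrite ?andbF // sB.
Qed.

Lemma tzn_splits b : splits b [set: V] -> tzn e <= b.
Proof.
move=> /splits_tree[N [m [tN _ inN inj cr]]].
have mN v : m v \in N by apply: inN; rewrite inE.
pose T := @OliveTree V N (fun v => [` mN v]%fset) tN
  (fun u v uv => inj u v (in_setT u) (in_setT v) (congr1 val uv)).
rewrite /tzn; case: ex_minnP => k _ /(_ (olive_tzn e T)) lek.
apply: leq_trans (lek _) _; first by apply/asboolP; exists T.
apply/bigmax_leqP => s ps; apply/bigmax_leqP_seq => p pN _.
rewrite (_ : olive_part T p = [set v in [set: V] | prefix p (m v)]); first exact: cr.
by apply/setP => v; rewrite !inE /= mN.
Qed.

(** * Top-down splitting by balanced separators *)

Definition balanced k : Prop := forall Z,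
  exists2 X : {set V}, #|X| <= k + 1 &
    forall u, u \notin X -> 2 * #|Z :&: scc e X u| <= #|Z|.

(** Two nested inductions: on the size of K, for passing to a strong component with a new guard, and
    on the size of U, for peeling K piece by piece with S fixed. *)
Lemma splits_convex k Z K :
    balanced k -> convex e Z K -> #|Z| <= 2 * k + 4 ->
  splits (6 * k + 14) K.
Proof.
move=> bal; have [n] := ubnP #|K|; elim: n => // n IHn in Z K *.
rewrite ltnS => leKn cvx leZ.
have [->|[v vK]] := set_0Vmem K; first exact: splits0.
have [X0 leX0 balX0] := bal Z.
(* Since v is in K and in S, every strong component of G - S inside K is strictly smaller than K. *)
pose X := v |: X0; pose S := Z :|: X.
have leX : #|X| <= k + 2 by rewrite cardsU1; case: (v \notin X0); lia.
have vS : v \in S by rewrite !inE eqxx orbT.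
(* Here |S| is at most (2k + 4) + (k + 2) = 3k + 6. *)
have leS : 2 * #|S| + 2 <= 6 * k + 14.
  have := (leq_card_setU Z X).1; rewrite -/S; lia.
have ZS : Z \subset S by apply: subsetUl.
(* The vertices met after leaving K in G - Z; by convexity K cannot be reached again from them
   without meeting Z. *)
pose T := [set y | (y \notin K) && [exists x in K, connect (avoid e Z) x y]].
have dZK : [disjoint Z & K] by case: cvx.
have KZ x : x \in K -> x \notin Z by move=> xK; rewrite (disjointFl dZK).
have TZ x : x \in T -> x \notin Z.
  rewrite inE => /andP[_ /exists_inP[y yK]].
  by apply: connect_avoid_notin; apply: KZ.
have Tstep x y : x \in T -> e x y -> y \notin Z -> y \in T.
  move=> xT exy yZ; have xZ := TZ x xT.
  have xy : connect (avoid e Z) x y by apply: connect1; rewrite /avoid /= exy xZ yZ.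
  move: (xT); rewrite inE => /andP[xK /exists_inP[z zK zx]].
  rewrite inE; apply/andP; split.
    by apply: contra xK => yK; case: cvx => _ cvx; apply: (cvx z x y).
  by apply/exists_inP; exists z => //; apply: connect_trans xy.
have Kstep x y : x \in K -> e x y -> y \notin Z -> y \notin K -> y \in T.
  move=> xK exy yZ yK; rewrite inE yK; apply/exists_inP; exists x => //.
  by apply: connect1; rewrite /avoid /= exy (KZ x) // yZ.
have TK x : x \in T -> x \notin K by rewrite inE => /andP[].
(* A walk from a good U that avoids S can leave U only into T, which gives the crossing bound; K
   itself is good. *)
pose good U := U \subset K /\
  forall x y, x \in U -> e x y -> y \in K -> y \notin S -> y \in U.
suff main U : good U -> splits (6 * k + 14) U by apply: main; split.
have [d] := ubnP #|U|; elim: d => // d IHd in U *; rewrite ltnS => leUd [UK Uout].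
have inSN y : y \notin S -> y \notin Z by apply: contra => /(subsetP ZS).
have crU : crossing_le (6 * k + 14) U.
  apply: (@crossing_le_sep U S T) leS.
  - move=> y z yUT eyz; rewrite in_setU negb_or => /andP[zU zS].
    have /orP[yU|yT] : (y \in U) || (y \in T) by rewrite -in_setU.
      2: exact: Tstep yT eyz (inSN _ zS).
    apply: (Kstep y) => //; [exact: (subsetP UK)|exact: inSN|].
    by apply: contra zU => zK; apply: Uout eyz zK zS.
  - move=> y z yT eyz; apply/negP => zU; have zK := subsetP UK z zU.
    by have := TK _ (Tstep _ _ yT eyz (KZ _ zK)); rewrite zK.
  by rewrite disjoint_subset; apply/subsetP => y /TK; apply: contra; apply: subsetP.
(* A vertex of S is peeled off as the single leftover vertex, with an empty second child. Goodness
   survives because it ignores edges into S. *)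
have [US0|[u]] := set_0Vmem (U :&: S); last first.
  rewrite inE => /andP[uU uS].
  apply: (@splitsU _ U (U :\ u) set0) => //.
  - by rewrite setU0 subsetDl.
  - by rewrite -setI_eq0 setI0.
  - by rewrite setU0 setDDr setDv set0U (setIidPr _) ?cards1 // sub1set.
  - apply: IHd; first by move: leUd; rewrite (cardsD1 u U) uU; lia.
    split=> [|x y]; first exact: subset_trans (subsetDl _ _) UK.
    rewrite !in_setD1 => /andP[_ xU] exy yK yS; rewrite (Uout x y) // andbT.
    by apply: contra yS => /eqP->.
  exact: splits0.
have UnS x : x \in U -> x \notin S.
  by move=> xU; apply/negP => xS; have := in_set0 x; rewrite -US0 inE xU xS.
have [->|[u0 u0U]] := set_0Vmem U; first exact: splits0.
(* A vertex with a largest reachable set lies in a source component. *)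
pose reach x := [set y | connect (avoid e S) x y].
have [u uU umax] : exists2 u, u \in U & forall x, x \in U -> #|reach x| <= #|reach u|.
  by case: (arg_maxnP (fun x => #|reach x|) u0U) => u uU umax; exists u.
have [uK uS] := (subsetP UK u uU, UnS u uU).
pose C := scc e S u.
have TS x y : connect (avoid e S) x y -> x \in T -> y \in T.
  move=> /connectP[p + ->]; elim: p x => //= z p IHp x /andP[/and3P[exz _ zS] pz] xT.
  by apply: IHp pz _; apply: Tstep xT exz (inSN _ zS).
have UTS x y : connect (avoid e S) x y -> x \in U -> y \in U :|: T.
  move=> /connectP[p + ->]; elim: p x => [|z p IHp] x /=; first by rewrite inE => _ ->.
  move=> /andP[/and3P[exz _ zS] pz] xU.
  have [zK|zK] := boolP (z \in K); first by apply: IHp pz (Uout x z _ _ _ _).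
  rewrite inE (TS z) ?orbT //; first by apply/connectP; exists p.
  by apply: (Kstep x) => //; [apply: (subsetP UK)|apply: inSN].
have CU : C \subset U.
  apply/subsetP => y; rewrite inE => /andP[uy yu].
  have := UTS _ _ uy uU; rewrite inE => /orP[//|yT].
  by have := TK _ (TS _ _ yu yT); rewrite uK.
have uC : u \in C by rewrite inE connect0.
apply: (@splitsU _ U C (U :\: C)) => //.
- by rewrite subUset CU subsetDl.
- by rewrite -setI_eq0 setIDA setIC -setIDA setDv setI0.
- by rewrite -{1}(setIidPr CU) setID setDv cards0.
(* Balance leaves at most k + 2 vertices of Z, and X has at most k + 2. *)
- apply: (IHn ((Z :&: scc e X u) :|: X)).
  + apply: leq_trans leKn; apply: proper_card; apply/properP.
    split; first exact: subset_trans CU UK.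
    by exists v => //; apply/negP => /(subsetP CU) /UnS; rewrite vS.
  + exact: convex_scc_guard.
  have uX0 : u \notin X0 by apply: contra uS => uX0; rewrite !inE uX0 !orbT.
  have := balX0 u uX0.
  have : #|Z :&: scc e X u| <= #|Z :&: scc e X0 u|.
    by apply/subset_leq_card/setIS/sccS/subsetUr.
  have := (leq_card_setU (Z :&: scc e X u) X).1; lia.
apply: IHd.
  by apply: leq_trans leUd; apply: proper_card; apply/properP; split;
     [apply: subsetDl|exists u; rewrite // inE uC].
split=> [|x y]; first exact: subset_trans (subsetDl _ _) UK.
rewrite !in_setD => /andP[xC xU] exy yK yS.
rewrite (Uout x y) // andbT; apply: contra xC.
rewrite !inE => /andP[uy yu].
have xu : connect (avoid e S) x u.
  by apply: connect_trans yu; apply: connect1; rewrite /avoid /= exy yS UnS.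
(* An edge from x into C makes x reach u; maximality of [reach u] then forces equality, so u reaches
   x and x is in C. *)
have sub : reach u \subset reach x.
  by apply/subsetP => z; rewrite !inE; apply: connect_trans.
have /setP/(_ x) : reach u = reach x by apply/eqP; rewrite eqEcard sub umax.
by rewrite !inE connect0 xu => ->.
Qed.

(** * Balanced separators from an arboreal decomposition *)

Lemma balanced_arboreal (D : arboreal e) : balanced (arb_width D).
Proof.
(* For empty Z no node is heavy, so this case is separate. *)
move=> Z; have [->|[z0 z0Z]] := set_0Vmem Z.
  by exists set0; rewrite ?cards0 // => u _; rewrite set0I cards0.
pose N := arb_nodes D; have [pc _] := arb_is_tree D.
pose part p := \bigcup_(u <- descendants N p) arb_bag u.
have partP x p : reflect (exists2 q, (q \in N) && prefix p q & x \in arb_bag q)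
                         (x \in part p).
  apply: (iffP idP) => [|[q qN xq]].
    rewrite /part big_tnth => /bigcupP[i _ xi]; exists (tnth (in_tuple _) i) => //.
    by have := mem_tnth i (in_tuple (descendants N p)); rewrite !inE.
  by rewrite /part (big_rem q) /= ?inE ?xq // inE.
have cover x : exists2 q, q \in N & x \in arb_bag q.
  have := in_setT x; rewrite -(arb_bag_cover D) big_tnth => /bigcupP[i _ xi].
  by exists (tnth (in_tuple _) i) => //; apply: mem_tnth.
have part0 x : x \in part [::].
  by have [q qN xq] := cover x; apply/partP; exists q; rewrite // qN prefix0s.
have root : [::] \in N by have [q qN _] := cover z0; apply: pc qN; apply: prefix0s.
have cvx p j : rcons p j \in N ->
    ((p, rcons p j) \in arcs N) /\ convex e (arb_guard (p, rcons p j)) (part (rcons p j)).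
  move=> pjN; have aN : (p, rcons p j) \in arcs N.
    rewrite !inE /= pjN (pc p _ _ pjN) ?prefix_rcons //=.
    by apply/existsP; exists j.
  by split=> //; apply: convex_normal; apply: arb_normal aN.
pose heavy (p : N) := #|Z| < 2 * #|Z :&: part (val p)|.
have heavy0 : heavy [` root]%fset.
  rewrite /heavy /= (_ : Z :&: _ = Z); last by apply/setIidPl/subsetP => x _.
  by have : 0 < #|Z| by [apply/card_gt0P; exists z0]; lia.
case: (arg_maxnP (fun p : N => size (val p)) heavy0) => -[p pN] /= heavyp pmax.
have guard_ball a : a \in arcs N -> (a.1 == p) || (a.2 == p) ->
    arb_guard a \subset arb_ball p.
  move=> aN ap; apply: subsetU; apply/orP; right.
  by rewrite (big_rem a) //= ap subsetUl.
exists (arb_ball p) => [|u uX].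
  by rewrite /arb_width; case: ex_minnP => w /allP/(_ p pN).
(* The ball of p contains the guards of all arcs at p, so a component of its complement cannot
   straddle the subtree of p or of a child. *)
have scc_part q j : rcons q j \in N -> (q == p) || (rcons q j == p) ->
    forall x, x \in part (rcons q j) -> scc e (arb_ball p) x \subset part (rcons q j).
  move=> qjN qp x xq; have [aN cv] := cvx q j qjN.
  by apply: convex_scc cv _ xq; apply: guard_ball.
(* Below p, u lies under some child, which is not heavy since p is deepest. Otherwise its component
   misses [part p] and gets less than half of Z. *)
have [up|up] := boolP (u \in part p).
  have /partP[q /andP[qN /prefixP[t qE]] uq] := up.
  case: t => [|j t] in qE.
    by move: uX; rewrite /arb_ball inE negb_or -{1}[p]cats0 -qE uq.
  have jN : rcons p j \in N by apply: pc qN; rewrite qE -cat_rcons prefix_prefix.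
  have uj : u \in part (rcons p j).
    by apply/partP; exists q; rewrite // qN qE -cat_rcons prefix_prefix.
  have : ~~ heavy [` jN]%fset.
    by apply/negP => /pmax; rewrite /= size_rcons ltnn.
  rewrite -leqNgt /=; apply: leq_trans; rewrite leq_mul2l /=.
  by apply/subset_leq_card/setIS/scc_part; rewrite ?eqxx.
have sub : Z :&: scc e (arb_ball p) u \subset Z :\: part p.
  rewrite setDE; apply: setIS; apply/subsetP => y; rewrite inE => /andP[uy yu].
  rewrite inE; apply/negP => yp; case/negP: up.
  (* The root has no incoming arc, but its part is all of V; any other node is rewritten as a child
     of its parent. *)
  have pN1 := pN; case: {-2}p (erefl p) pN1 yp => [|i p'] pE; first by rewrite part0.
  rewrite lastI => piN yp.
  have := scc_part _ _ piN _ y yp; rewrite -lastI pE eqxx orbT => /(_ isT) /subsetP.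
  by apply; rewrite inE yu uy.
have := subset_leq_card sub; have := cardsID (part p) Z; rewrite /heavy /= in heavyp; lia.
Qed.

End Crossing.

Theorem theorem3 (V : finType) (e : rel V) : tzn e <= 9 * dtw e + 18.
Proof.
rewrite /dtw; case: ex_minnP => k /asboolP[D <-] _.
apply: (@leq_trans (6 * arb_width D + 14)); last by lia.
(* The splitting starts from all of V with the empty guard. *)
apply/tzn_splits/(splits_convex (Z := set0) (balanced_arboreal D)); last by rewrite cards0.
by split=> [|*]; rewrite ?inE // -setI_eq0 set0I.
Qed.
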